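(* Let $p\in(1,2)$, let $E$ and $F$ be Banach lattices, and let $\iota:F\to E$ be a linear isomorphic embedding such that $\iota(F)$ is complemented in $E$ or, more generally, such that $(\iota(F),E)$ has the POE-$1$. If $E$ has an upper $p$-estimate, then $F$ has an upper $p$-estimate.
   Context: Banach lattices are real. For a closed subspace $G$ of a Banach space $E$, the pair $(G,E)$ has the POE-$1$ if there is a constant $C$ such that for every $n\in\mathbb N$ every linear operator $T:G\to\ell_1^n$ extends to an operator $\widetilde T:E\to\ell_1^n$ with $\|\widetilde T\|\le C\|T\|$. A Banach lattice $X$ has an upper $p$-estimate if there is $C$ with $\|\bigvee_{k=1}^n|x_k|\|\le C(\sum_{k=1}^n\|x_k\|^p)^{1/p}$ for all $x_1,\dots,x_n\in X$. The embedding $\iota$ need not respect the order. *)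

(* Defs.v *)
From HB Require Import structures.
From mathcomp Require Import all_boot all_order all_algebra.
From mathcomp Require Import all_classical all_reals all_analysis.

Set Implicit Arguments.
Unset Strict Implicit.
Unset Printing Implicit Defensive.

Import Order.TTheory GRing.Theory Num.Theory.
Import numFieldNormedType.Exports.

Local Open Scope classical_set_scope.
Local Open Scope ring_scope.

(* The order and the lattice operations are fields of the mixin, not inherited
   from latticeType: realDomainType already combines a zmodType with a lattice
   and HB then rejects a structure that combines them anew. The alias
   [vlattice] below recovers the library's lattice theory.
   [vle_norm] is monotonicity of the norm for the modulus x \/ (- x). *)
HB.mixin Record CompleteNormedModule_isBanachLattice (R : realType) E
    & CompleteNormedModule R E := {
  vle : rel E ;
  vmeet : E -> E -> E ;
  vjoin : E -> E -> E ;
  vle_refl : reflexive vle ;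
  vle_anti : antisymmetric vle ;
  vle_trans : transitive vle ;
  vmeetP : forall x y z, vle x (vmeet y z) = vle x y && vle x z ;
  vjoinP : forall x y z, vle (vjoin x y) z = vle x z && vle y z ;
  vleD2r : forall z x y, vle x y -> vle (x + z) (y + z) ;
  vleZ2l : forall (a : R) x y, 0 <= a -> vle x y -> vle (a *: x) (a *: y) ;
  vle_norm : forall x y, vle (vjoin x (- x)) (vjoin y (- y)) -> `|x| <= `|y|
}.

#[short(type="banachLatticeType")]
HB.structure Definition BanachLattice (R : realType) :=
  {E of CompleteNormedModule R E & CompleteNormedModule_isBanachLattice R E}.

Definition vlattice (R : realType) (X : banachLatticeType R) : Type := X.

Section vlattice.
Context {R : realType} {X : banachLatticeType R}.

HB.instance Definition _ := Choice.copy (vlattice X) X.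

HB.instance Definition _ := Order.Le_isPOrder.Build ring_display (vlattice X)
  (@vle_refl R X) (@vle_anti R X) (@vle_trans R X).

HB.instance Definition _ := Order.POrder_MeetJoin_isLattice.Build
  ring_display (vlattice X) (@vmeetP R X) (@vjoinP R X).

End vlattice.

Definition modulus (R : realType) (X : banachLatticeType R) (x : X) : X :=
  vjoin x (- x).

(* Moduli are nonnegative, so starting the finite join from 0 does not change
   it when 0 < n; the inequality is trivial when n = 0. *)
Definition upper_estimate (R : realType) (p : R) (X : banachLatticeType R) :=
  exists C : R, forall (n : nat) (x : 'I_n -> X),
    `|\big[vjoin/0]_(k < n) modulus (x k)|
      <= C * (\sum_(k < n) `|x k| `^ p) `^ p^-1.

(* The norm of the library on 'rV[R]_n is the sup norm, hence the alias. *)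
Definition ell1 (R : realType) (n : nat) : Type := 'rV[R]_n.

Section ell1.
Context {R : realType} {n : nat}.

HB.instance Definition _ := GRing.Lmodule.copy (ell1 R n) 'rV[R]_n.

Definition ell1_norm (x : ell1 R n) : R := \sum_(i < n) `|(x : 'rV[R]_n) 0 i|.

Let ell1_normD (x y : ell1 R n) :
  ell1_norm (x + y) <= ell1_norm x + ell1_norm y.
Proof.
by rewrite /ell1_norm -big_split/=; apply: ler_sum => i _; rewrite mxE ler_normD.
Qed.

Let ell1_normZ (a : R) (x : ell1 R n) :
  ell1_norm (a *: x) = `|a| * ell1_norm x.
Proof.
by rewrite /ell1_norm mulr_sumr; apply: eq_bigr => i _; rewrite mxE normrM.
Qed.

Let ell1_norm0_eq0 (x : ell1 R n) : ell1_norm x = 0 -> x = 0.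
Proof.
move=> /eqP; rewrite psumr_eq0// => /allP x0; apply/rowP => i; rewrite mxE.
by apply/eqP; rewrite -normr_eq0; apply: x0; rewrite mem_index_enum.
Qed.

HB.instance Definition _ := Lmodule_isNormed.Build R (ell1 R n)
  ell1_normD ell1_normZ ell1_norm0_eq0.

End ell1.

(* An operator on a linear subspace G of E is represented by a function on E
   whose values outside G are irrelevant. *)
Section operators.
Context {R : realType} {E V : normedModType R}.
Implicit Types (G : set E) (T : E -> V).

Definition linear_on G T := forall (a : R) (x y : E),
  G x -> G y -> T (a *: x + y) = a *: T x + T y.

Definition bounded_operator_on G T :=
  exists M : R, forall x : E, G x -> `|T x| <= M * `|x|.

(* Meaningful when [bounded_operator_on G T]. *)
Definition operator_norm_on G T : R :=
  sup [set `|T x| | x in G `&` [set x | `|x| <= 1]].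

End operators.

Section embeddings.
Context {R : realType}.

Definition isomorphic_embedding (F E : normedModType R) (f : {linear F -> E}) :=
  exists c C : R, 0 < c /\ forall x : F, c * `|x| <= `|f x| <= C * `|x|.

Definition complemented (E : normedModType R) (G : set E) :=
  exists P : {linear E -> E},
    [/\ continuous P, forall x, P (P x) = P x & range P = G].

Definition POE1 (E : normedModType R) (G : set E) :=
  exists C : R, forall (n : nat) (T : E -> ell1 R n),
    linear_on G T -> bounded_operator_on G T ->
    exists T' : {linear E -> ell1 R n},
      [/\ bounded_operator_on setT T',
          forall x, G x -> T' x = T x &
          operator_norm_on setT T' <= C * operator_norm_on G T].

End embeddings.

(* Main.v *)
Require Import Defs.
From HB Require Import structures.
From mathcomp Require Import all_boot all_order all_algebra.
From mathcomp Require Import all_classical all_reals all_analysis.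
From mathcomp Require Import ring lra.
Import Order.TTheory GRing.Theory Num.Theory.
Import numFieldNormedType.Exports.

Set Implicit Arguments.
Unset Strict Implicit.
Unset Printing Implicit Defensive.

Local Open Scope classical_set_scope.
Local Open Scope ring_scope.

(* Hahn-Banach for the seminorm y |-> || \/_k |y_k| || on F^n gives functionals
   f_k with sum_k f_k(x_k) = || \/_k |x_k| || and sum_k |f_k(y)| <= ||y||, that
   is, an operator from F to l_1^n, which extends to g : E -> l_1^n. Hence it is
   enough to show, in E, that sum_k g_k(x_k) <= C ||g|| (sum_k ||x_k||^p)^(1/p).

   Let Y be the random sum sum_j e_j x_j with independent signs e_j, truncated
   at the random level u = 6 \/_j t_j |x_j|, where the t_j are independent with
   P(t_j^2 > s) ~ 1/s. As p < 2, the moment of order p of t_j is bounded, so the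
   upper p-estimate bounds the average of ||u||, and with it
   sum_k g_k(avg (e_k Y)) = avg (sum_k e_k g_k(Y)) <= ||g|| avg ||u||.
   For real x_j the level u exceeds the random sum with probability at least
   3/4, since u is comparable to (sum_j x_j^2)^(1/2); this yields
   |x_k - avg (e_k Y)| <= |x_k| / 2, an inequality that transfers to E through
   real-valued lattice homomorphisms. Iterating it gives the bound. *)

(** * Hahn-Banach theorem with prescribed joins *)

Section sublinear.
Context {R : realType} {V : lmodType R}.
(* [J x y z] stands for [z = x \/ y]; with the empty relation,
   [sublinear_dominates] below is the Hahn-Banach theorem. *)
Variables (D : set V) (J : V -> V -> V -> Prop).
Hypothesis DD : forall x y, D x -> D y -> D (x + y).
Hypothesis DZ : forall (a : R) x, D x -> D (a *: x).
Hypothesis JD : forall x y z, J x y z -> [/\ D x, D y & D z].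
Hypothesis JT : forall t x y z, D t -> J x y z -> J (x + t) (y + t) (z + t).
Implicit Types (p q f : V -> R) (x y z : V).

(** The scaling clause is an inequality for [0 < a], which is easy to check for infima; [sublinZ]
    recovers equality by applying it to [a^-1] as well. *)
Record sublinear q : Prop := Sublinear {
  sublinD : forall x y, D x -> D y -> q (x + y) <= q x + q y ;
  sublinZ_le : forall a x, 0 < a -> D x -> q (a *: x) <= a * q x ;
  sublinJ : forall x y z, J x y z -> q z = Num.max (q x) (q y) }.

Lemma sublin0 q x : sublinear q -> D x -> q 0 = 0.
Proof.
move=> sq Dx; have D0 : D 0 by rewrite -(scale0r x); exact: DZ.
have h2 : q 0 <= 2 * q 0 by rewrite -{1}(scaler0 V 2); exact: sublinZ_le.
have h1 : q 0 <= 2^-1 * q 0.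
  by rewrite -{1}(scaler0 V 2^-1); apply: sublinZ_le; rewrite // invr_gt0.
lra.
Qed.

Lemma sublinZ q a x : sublinear q -> 0 <= a -> D x -> q (a *: x) = a * q x.
Proof.
move=> sq; rewrite le_eqVlt => /predU1P[<-|a0] Dx.
  by rewrite scale0r mul0r (sublin0 sq Dx).
apply/eqP; rewrite eq_le sublinZ_le//= -ler_pdivlMl//.
rewrite -{1}(scale1r x) -(mulVf (lt0r_neq0 a0)) -scalerA.
by apply: sublinZ_le; rewrite ?invr_gt0//; exact: DZ.
Qed.

Lemma DN x : D x -> D (- x).
Proof. by rewrite -scaleN1r; exact: DZ. Qed.

Lemma sublinN_ge q x : sublinear q -> D x -> - q (- x) <= q x.
Proof.
move=> sq Dx; have := sublinD sq Dx (DN Dx).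
by rewrite subrr (sublin0 sq Dx); lra.
Qed.

(** The index may change in the clauses on sums and multiples, since the members of a tilted family
    are not sublinear one by one. Downward directedness gives joins: if [h i x] and [h j y] lay
    below the infimum at [z], so would [h k z] for a common lower [k]. *)
Lemma sublinear_inf (I : Type) (i0 : I) (h : I -> V -> R) (l : V -> R) :
  (forall i x, D x -> l x <= h i x) ->
  (forall i j x y, D x -> D y -> exists k, h k (x + y) <= h i x + h j y) ->
  (forall i a x, 0 < a -> D x -> exists k, h k (a *: x) <= a * h i x) ->
  (forall i x y z, J x y z -> h i z = Num.max (h i x) (h i y)) ->
  (forall i j, exists k, forall x, D x -> h k x <= h i x /\ h k x <= h j x) ->
  sublinear (fun x => inf (range (h ^~ x))).
Proof.
move=> lh hD hZ hJ hdir.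
have lb x : D x -> has_lbound (range (h ^~ x)).
  by move=> Dx; exists (l x) => _ [i _ <-]; exact: lh.
have infle i x : D x -> inf (range (h ^~ x)) <= h i x.
  by move=> Dx; apply: ge_inf; [exact: lb|exists i].
have leinf r x : (forall i, r <= h i x) -> r <= inf (range (h ^~ x)).
  move=> rh; apply: lb_le_inf; first by exists (h i0 x), i0.
  by move=> _ [i _ <-].
split=> [x y Dx Dy|a x a0 Dx|x y z Jxyz].
- rewrite -lerBlDr; apply: (leinf) => i; rewrite lerBlDr -lerBlDl.
  apply: leinf => j; rewrite lerBlDl.
  by have [k] := hD i j _ _ Dx Dy; apply: le_trans; apply: infle; exact: DD.
- rewrite -ler_pdivrMl//; apply: leinf => i; rewrite ler_pdivrMl//.
  by have [k] := hZ i _ _ a0 Dx; apply: le_trans; apply: infle; exact: DZ.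
have [Dx Dy Dz] := JD Jxyz; apply/eqP; rewrite eq_le; apply/andP; split.
  rewrite leNgt; apply/negP; rewrite gt_max => /andP[ltx lty].
  have inf_lt v : inf (range (h ^~ v)) < inf (range (h ^~ z)) ->
      exists i, h i v < inf (range (h ^~ z)).
    by move=> /inf_lt[|_ [i _ <-] ?]; [exists (h i0 v), i0|exists i].
  have [[i ix] [j jy]] := (inf_lt _ ltx, inf_lt _ lty).
  have [k hk] := hdir i j; have := infle k _ Dz; rewrite (hJ _ _ _ _ Jxyz).
  apply/negP; rewrite -ltNge gt_max.
  by rewrite (le_lt_trans (hk _ Dx).1)// (le_lt_trans (hk _ Dy).2).
by rewrite ge_max; apply/andP; split; apply: leinf => i;
  rewrite (hJ _ _ _ _ Jxyz) le_max infle ?orbT.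
Qed.

(** Take the infimum over [t >= 0] of [q (x + t *: y) - t * q y]: the value at [t = 0] gives
    [r <= q], the one at [t = 1] bounds [r (- y)]. *)
Lemma sublin_tilt q y : sublinear q -> D y ->
  exists r, [/\ sublinear r, forall x, D x -> r x <= q x & r (- y) <= - q y].
Proof.
move=> sq Dy.
pose h (t : {t : R | 0 <= t}) x := q (x + sval t *: y) - sval t * q y.
have lbh t x : D x -> - q (- x) <= h t x.
  move=> Dx; rewrite /h; case: t => t /= t0; rewrite -(sublinZ sq t0 Dy).
  have := sublinD sq (DN Dx) (DD Dx (DZ t Dy)).
  by rewrite addKr; lra.
have t0 : {t : R | 0 <= t} by exists 0.
have anti s t x : D x -> sval s <= sval t -> h t x <= h s x.
  move=> Dx; rewrite /h; case: s t => s s0 [t t0']/= st.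
  rewrite (_ : x + t *: y = x + s *: y + (t - s) *: y); last first.
    by rewrite -addrA -scalerDl (addrC s) subrK.
  have := sublinD sq (DD Dx (DZ s Dy)) (DZ (t - s) Dy).
  by rewrite (sublinZ sq _ Dy) ?subr_ge0//; lra.
have infle t x : D x -> inf (range (h ^~ x)) <= h t x.
  move=> Dx; apply: ge_inf; last by exists t.
  by exists (- q (- x)) => _ [i _ <-]; exact: lbh.
exists (fun x => inf (range (h ^~ x))); split.
- apply: (sublinear_inf t0 lbh).
  + move=> [s s0] [t t0'] x z Dx Dz.
    exists (exist _ (s + t) (addr_ge0 s0 t0')); rewrite /h /=.
    have := sublinD sq (DD Dx (DZ s Dy)) (DD Dz (DZ t Dy)).
    by rewrite addrACA -scalerDl; lra.
  + move=> [t t0'] a x a0 Dx.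
    exists (exist _ (a * t) (mulr_ge0 (ltW a0) t0')); rewrite /h /=.
    rewrite -scalerA -scalerDr (sublinZ sq (ltW a0)); first lra.
    exact: DD Dx (DZ t Dy).
  + move=> t x z v Jv; rewrite /h (sublinJ sq (JT (DZ (sval t) Dy) Jv)).
    by rewrite addr_maxl.
  + move=> s t; exists (if sval s <= sval t then t else s) => x Dx.
    by case: (leP (sval s) (sval t)) => st;
      rewrite lexx; split=> //; apply: anti => //; exact: ltW.
- move=> x Dx; apply: le_trans (infle (exist _ 0 (lexx 0)) x Dx) _.
  by rewrite /h /= scale0r addr0 mul0r subr0.
- apply: le_trans (infle (exist _ 1 ler01) _ (DN Dy)) _.
  by rewrite /h /= scale1r addNr mul1r (sublin0 sq Dy) sub0r.
Qed.

(** Zorn's lemma: a chain below [p] has a pointwise infimum, finite because each member is at least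
    [- p (- x)] at [x]. *)
Lemma sublin_minimal p : sublinear p ->
  exists q, [/\ sublinear q, forall x, D x -> q x <= p x &
    forall r, sublinear r -> (forall x, D x -> r x <= q x) ->
      forall x, D x -> q x <= r x].
Proof.
move=> sp.
pose T := {q | sublinear q /\ forall x, D x -> q x <= p x}.
(* The order is reversed, so that a maximal element is a minimal functional. *)
pose le (s t : T) := `[< forall x, D x -> sval t x <= sval s x >].
have p' : T by exists p; split.
have [| | |[q [sq qp]] minq] := @ZL_preorder T p' le.
- by move=> s; apply/asboolP => x _.
- move=> r s t /asboolP rs /asboolP st; apply/asboolP => x Dx.
  exact: le_trans (st _ Dx) (rs _ Dx).
- move=> A totA.
  have [[q0 Aq0]|A0] := pselect (exists s : T, A s); last first.
    by exists p' => s As; case: A0; exists s.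
  pose h (i : {s | A s}) := sval (sval i).
  have shi i : sublinear (h i) := (svalP (sval i)).1.
  have hp i x : D x -> h i x <= p x := (svalP (sval i)).2 x.
  have lbh i x : D x -> - p (- x) <= h i x.
    move=> Dx; apply: le_trans (sublinN_ge (shi i) Dx).
    by rewrite lerN2; exact: hp (DN Dx).
  have hdir i j : exists k, forall x, D x -> h k x <= h i x /\ h k x <= h j x.
    case: i j => [i Ai] [j Aj]; have [/asboolP|/asboolP] := totA _ _ Ai Aj.
    - by move=> ij; exists (exist _ j Aj) => x Dx; split=> //; exact: ij.
    - by move=> ij; exists (exist _ i Ai) => x Dx; split=> //; exact: ij.
  have infle i x : D x -> inf (range (h ^~ x)) <= h i x.
    move=> Dx; apply: ge_inf; last by exists i.
    by exists (- p (- x)) => _ [j _ <-]; exact: lbh.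
  pose q x := inf (range (h ^~ x)).
  have sq : sublinear q.
    apply: (sublinear_inf (exist _ q0 Aq0) lbh) => //.
    + move=> i j x y Dx Dy; have [k hk] := hdir i j; exists k.
      apply: le_trans (sublinD (shi k) Dx Dy) _.
      by apply: lerD; [exact: (hk _ Dx).1|exact: (hk _ Dy).2].
    + by move=> i a x a0 Dx; exists i; exact: sublinZ_le.
    + by move=> i x y z; exact: sublinJ.
  have qp x : D x -> q x <= p x.
    move=> Dx; apply: le_trans (infle (exist _ q0 Aq0) x Dx) _; exact: hp.
  exists (exist _ q (conj sq qp)) => s As; apply/asboolP => x Dx /=.
  exact: (infle (exist _ s As)).
exists q; split=> // r sr rq x Dx.
have rp z : D z -> r z <= p z by move=> Dz; apply: le_trans (rq _ Dz) (qp _ Dz).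
suff /asboolP : le (exist _ r (conj sr rp)) (exist _ q (conj sq qp)) by exact.
by apply: minq; apply/asboolP.
Qed.

(* A minimal [q] satisfies [q (- y) <= - q y] for every [y], because tilting it
   towards [y] stays in the class. Tilting preserves joins since
   [t |-> q (x + t y) - t q y] is nonincreasing. *)
Theorem sublinear_dominates p w : sublinear p -> D w ->
  exists f, [/\ forall a x y, D x -> D y -> f (a *: x + y) = a * f x + f y,
    forall x, D x -> f x <= p x, f w = p w &
    forall x y z, J x y z -> f z = Num.max (f x) (f y)].
Proof.
(* Tilting towards [w] first gives [p' (- w) <= - p w], hence [f w >= p w] for every linear [f]
   below [p']. *)
move=> sp Dw; have [p' [sp' p'p p'w]] := sublin_tilt sp Dw.
have [f [sf fp' minf]] := sublin_minimal sp'.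
have fN x : D x -> f (- x) = - f x.
  move=> Dx; apply/eqP; rewrite eq_le; apply/andP; split.
    have [r [sr rf rx]] := sublin_tilt sf Dx.
    by apply: le_trans rx; apply: minf => //; exact: DN.
  by rewrite lerNl; exact: sublinN_ge.
have fD x y : D x -> D y -> f (x + y) = f x + f y.
  move=> Dx Dy; apply/eqP; rewrite eq_le sublinD//=.
  have := sublinD sf (DD Dx Dy) (DN Dy); rewrite addrK fN//; lra.
have fp x : D x -> f x <= p x.
  by move=> Dx; apply: le_trans (fp' _ Dx) (p'p _ Dx).
exists f; split=> //; last by move=> x y z; exact: sublinJ.
- move=> a x y Dx Dy; rewrite fD//; last exact: DZ; congr (_ + _).
  have [a0|a0] := leP 0 a; first exact: sublinZ.
  rewrite -[a]opprK scaleNr fN; last exact: DZ.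
  by rewrite sublinZ ?mulNr// oppr_ge0 ltW.
- apply/eqP; rewrite eq_le fp//= -lerN2 -fN//.
  by apply: le_trans p'w; exact: fp' (DN Dw).
Qed.

End sublinear.

(** * Order, modulus and norm in a Banach lattice *)

Arguments vle_trans {R s y x z}.
Arguments vleD2r {R s} z {x y}.
Arguments vleZ2l {R s a x y}.
Arguments vle_norm {R s x y}.

Section vector_lattice.
Context {R : realType} {X : banachLatticeType R}.
Implicit Types (x y z u : X) (a b c : R).

Lemma vjoin_ubl x y : vle x (vjoin x y).
Proof. by have := vle_refl (vjoin x y); rewrite vjoinP => /andP[]. Qed.

Lemma vjoin_ubr x y : vle y (vjoin x y).
Proof. by have := vle_refl (vjoin x y); rewrite vjoinP => /andP[]. Qed.

Lemma vjoin_lub x y z : vle x z -> vle y z -> vle (vjoin x y) z.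
Proof. by move=> xz yz; rewrite vjoinP xz. Qed.

Lemma vle_eq x y : vle x y -> vle y x -> x = y.
Proof. by move=> xy yx; apply: vle_anti; rewrite xy. Qed.

Lemma vleD x y z u : vle x y -> vle z u -> vle (x + z) (y + u).
Proof.
move=> xy zu; apply: (vle_trans (vleD2r z xy)).
by rewrite ![y + _]addrC; exact: vleD2r.
Qed.

Lemma vlerBlDr x y z : vle (x - y) z = vle x (z + y).
Proof.
apply/idP/idP => [/(vleD2r y)|/(vleD2r (- y))]; first by rewrite subrK.
by rewrite addrK.
Qed.

Lemma subv_le0 x y : vle (x - y) 0 = vle x y.
Proof. by rewrite vlerBlDr add0r. Qed.

Lemma vleN x y : vle x y -> vle (- y) (- x).
Proof.
by move=> xy; rewrite -[- y]add0r vlerBlDr addrC -vlerBlDr opprK add0r.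
Qed.

Lemma vleNl x y : vle (- x) y -> vle (- y) x.
Proof. by move=> /vleN; rewrite opprK. Qed.

Lemma vaddr_ge0 x y : vle 0 x -> vle 0 y -> vle 0 (x + y).
Proof. by move=> x0 y0; rewrite -[X in vle X _]addr0; exact: vleD. Qed.

Lemma vscaler_ge0 a x : 0 <= a -> vle 0 x -> vle 0 (a *: x).
Proof. by move=> a0 x0; rewrite -(scaler0 X a); exact: vleZ2l. Qed.

Lemma vleZr a b u : vle 0 u -> a <= b -> vle (a *: u) (b *: u).
Proof.
move=> u0 ab; rewrite -subv_le0 -scalerBl -opprB scaleNr.
apply: vleNl; rewrite oppr0 -(scaler0 X (b - a)).
by apply: vleZ2l; rewrite ?subr_ge0.
Qed.

Lemma vjoinDr x y z : vjoin (x + z) (y + z) = vjoin x y + z.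
Proof.
apply: vle_eq.
  by apply: vjoin_lub; apply: vleD2r; [exact: vjoin_ubl|exact: vjoin_ubr].
rewrite -[z]opprK vlerBlDr opprK; apply: vjoin_lub;
  rewrite -vlerBlDr opprK; [exact: vjoin_ubl|exact: vjoin_ubr].
Qed.

Lemma vle_modulus x : vle x (modulus x).
Proof. exact: vjoin_ubl. Qed.

Lemma vleN_modulus x : vle (- x) (modulus x).
Proof. exact: vjoin_ubr. Qed.

Lemma modulus_ge0 x : vle 0 (modulus x).
Proof.
have : vle 0 (modulus x + modulus x).
  by rewrite -(subrr x); apply: vleD; [exact: vle_modulus|exact: vleN_modulus].
have h : (0 : R) <= 2^-1 by rewrite invr_ge0.
move=> /(vleZ2l h); rewrite scaler0 scalerDr -scalerDl.
by rewrite (_ : 2^-1 + 2^-1 = 1 :> R) ?scale1r//; field.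
Qed.

Lemma modulus_lub x y : vle x y -> vle (- x) y -> vle (modulus x) y.
Proof. exact: vjoin_lub. Qed.

Lemma ger0_modulus x : vle 0 x -> modulus x = x.
Proof.
move=> x0; apply: vle_eq; last exact: vle_modulus.
apply: modulus_lub; first exact: vle_refl.
by apply: (vle_trans _ x0); apply: vleNl; rewrite oppr0.
Qed.

Lemma modulusD x y : vle (modulus (x + y)) (modulus x + modulus y).
Proof.
by apply: modulus_lub; rewrite ?opprD; apply: vleD;
  first [exact: vle_modulus|exact: vleN_modulus].
Qed.

Lemma modulusZ_le a x : vle (modulus (a *: x)) (`|a| *: modulus x).
Proof.
have [a0|/ltW a0] := leP 0 a.
  by rewrite ger0_norm//; apply: modulus_lub; rewrite -?scalerN;
    apply: vleZ2l => //; first [exact: vle_modulus|exact: vleN_modulus].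
rewrite ler0_norm// -[a in a *: x]opprK scaleNr -scalerN.
by apply: modulus_lub; rewrite -?scalerN ?opprK; apply: vleZ2l;
  rewrite ?oppr_ge0//; first [exact: vle_modulus|exact: vleN_modulus].
Qed.

Lemma norm_vle x u : vle x u -> vle (- x) u -> `|x| <= `|u|.
Proof.
move=> xu Nxu; apply: vle_norm; apply: vle_trans (vle_modulus u).
exact: modulus_lub.
Qed.

Lemma norm_modulus x : `|modulus x| = `|x|.
Proof.
apply/eqP; rewrite eq_le; apply/andP; split; apply: vle_norm;
  by rewrite -!/(modulus _) (ger0_modulus (modulus_ge0 x)); exact: vle_refl.
Qed.

Lemma vle_bigjoin (I : eqType) (r : seq I) (F : I -> X) i :
  i \in r -> vle (F i) (\big[vjoin/0]_(j <- r) F j).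
Proof.
elim: r => // j r IH; rewrite inE big_cons => /predU1P[->|ir].
  exact: vjoin_ubl.
exact: vle_trans (IH ir) (vjoin_ubr _ _).
Qed.

Lemma bigjoin_lub (I : eqType) (r : seq I) (F : I -> X) z :
  vle 0 z -> (forall i, i \in r -> vle (F i) z) ->
  vle (\big[vjoin/0]_(j <- r) F j) z.
Proof.
move=> z0 h; rewrite big_seq; elim/big_ind : _ => // x y.
exact: vjoin_lub.
Qed.

Lemma bigjoin_ge0 (I : Type) (r : seq I) (F : I -> X) :
  vle 0 (\big[vjoin/0]_(j <- r) modulus (F j)).
Proof.
case: r => [|j r]; first by rewrite big_nil vle_refl.
by rewrite big_cons; apply: vle_trans (modulus_ge0 (F j)) (vjoin_ubl _ _).
Qed.

(** The norm forces this: the positive part of [x - y] lies between 0 and [e *: u], so its norm is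
    at most [e * |u|] for every [e > 0]. *)
Lemma vle_archimedean x y u : vle 0 u ->
  (forall e : R, 0 < e -> vle x (y + e *: u)) -> vle x y.
Proof.
move=> u0 h; rewrite -subv_le0; set z := vjoin (x - y) 0.
suff -> : 0 = z by exact: vjoin_ubl.
apply/esym/eqP; rewrite -normr_eq0 eq_le normr_ge0 andbT.
have hz e : 0 < e -> `|z| <= e * `|u|.
  move=> e0; rewrite -[e in e * _]gtr0_norm// -normrZ.
  have eu0 : vle 0 (e *: u) by apply: vscaler_ge0 => //; exact: ltW.
  apply: norm_vle.
    by apply: vjoin_lub => //; rewrite vlerBlDr addrC; exact: h.
  by apply: (vle_trans _ eu0); apply: vleNl; rewrite oppr0; exact: vjoin_ubr.
apply/ler_addgt0Pl => e e0; rewrite addr0.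
have u1 : 0 < `|u| + 1 by rewrite ltr_wpDl.
apply: le_trans (hz (e / (`|u| + 1)) _) _; first by rewrite divr_gt0.
by rewrite -mulrA ger_pMr// mulrC ler_pdivrMr// mul1r lerDl.
Qed.

(** * Principal ideals and their lattice homomorphisms *)

Section principal_ideal.
Variable u : X.
Hypothesis u0 : vle 0 u.

Definition ideal : set X := [set x | exists c, vle (modulus x) (c *: u)].

Lemma idealD x y : ideal x -> ideal y -> ideal (x + y).
Proof.
move=> [c xc] [d yd]; exists (c + d); rewrite scalerDl.
exact: vle_trans (modulusD x y) (vleD xc yd).
Qed.

Lemma idealZ a x : ideal x -> ideal (a *: x).
Proof.
move=> [c xc]; exists (`|a| * c); rewrite -scalerA.
by apply: vle_trans (modulusZ_le a x) _; exact: vleZ2l.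
Qed.

Lemma ideal0 : ideal 0.
Proof. by exists 0; rewrite scale0r (ger0_modulus (vle_refl 0)) vle_refl. Qed.

Lemma idealN x : ideal x -> ideal (- x).
Proof. by rewrite -scaleN1r; exact: idealZ. Qed.

Lemma idealJ x y : ideal x -> ideal y -> ideal (vjoin x y).
Proof.
move=> [c xc] [d yd]; exists (c + d); rewrite scalerDl.
apply: vle_trans (vleD xc yd); apply: modulus_lub.
  apply: vjoin_lub; [rewrite -{1}[x]addr0|rewrite -{1}[y]add0r];
    by apply: vleD; first [exact: vle_modulus|exact: modulus_ge0].
rewrite -[- _]addr0; apply: vleD; last exact: modulus_ge0.
apply: vle_trans (vleN_modulus x); apply: vleN; exact: vjoin_ubl.
Qed.

Lemma ideal_sum (I : Type) (r : seq I) (F : I -> X) :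
  (forall i, ideal (F i)) -> ideal (\sum_(i <- r) F i).
Proof.
move=> h; elim/big_ind : _ => //; [exact: ideal0|exact: idealD].
Qed.

Lemma ideal_bigjoin (I : Type) (r : seq I) (F : I -> X) :
  (forall i, ideal (F i)) -> ideal (\big[vjoin/0]_(i <- r) F i).
Proof.
move=> h; elim/big_ind : _ => //; [exact: ideal0|exact: idealJ].
Qed.

(** One-sided, hence possibly negative: if the ideal is seen as functions on a compact space with
    [u] the constant one, this is the maximum of [x]. *)
Definition gauge x : R := inf [set c | vle x (c *: u)].

Hypothesis u_neq0 : u != 0.

(** The infimum is attained by the Archimedean property; [u != 0] keeps the set bounded below. *)
Lemma gauge_le x c : ideal x -> (gauge x <= c) = vle x (c *: u).
Proof.
move=> [d xd].
have vleZu a b : vle (a *: u) (b *: u) -> a <= b.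
  move=> ab; rewrite leNgt; apply/negP => ba.
  have h : vle ((a - b) *: u) 0 by rewrite scalerBl subv_le0.
  have /(vleZ2l)/(_ h) : 0 <= (a - b)^-1 by rewrite invr_ge0 subr_ge0 ltW.
  rewrite scalerA mulVf ?subr_eq0 ?gt_eqF// scale1r scaler0 => u_le0.
  by move: u_neq0; rewrite (vle_eq u_le0 u0) eqxx.
have lb : has_lbound [set c | vle x (c *: u)].
  exists (- d) => e /= xe; apply: vleZu; rewrite scaleNr.
  apply: vleNl; apply: vle_trans (vle_trans (vleN xe) _) (xd).
  exact: vleN_modulus.
have nx : [set c | vle x (c *: u)] !=set0.
  by exists d; apply: vle_trans xd; exact: vle_modulus.
apply/idP/idP => [gc|]; last by move=> xc; exact: ge_inf.
apply: (vle_archimedean u0) => e e0; rewrite -scalerDl.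
have [f xf fe] := inf_adherent e0 (conj nx lb).
apply: vle_trans xf _; apply: vleZr => //.
by rewrite ltW// (lt_le_trans fe)// lerD2r.
Qed.

Let isjoin x y z := [/\ ideal x, ideal y & z = vjoin x y].

Lemma gauge_sublinear : sublinear ideal isjoin gauge.
Proof.
split=> [x y ix iy|a x a0 ix|x y _ [ix iy ->]].
- rewrite gauge_le; last exact: idealD.
  by rewrite scalerDl; apply: vleD; rewrite -gauge_le.
- rewrite gauge_le; last exact: idealZ.
  by rewrite -scalerA; apply: vleZ2l; rewrite ?ltW// -gauge_le.
- have E c : (gauge (vjoin x y) <= c) = (Num.max (gauge x) (gauge y) <= c).
    by rewrite ge_max !gauge_le ?vjoinP//; exact: idealJ.
  by apply/eqP; rewrite eq_le E lexx -E lexx.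
Qed.

End principal_ideal.

(* Real-valued lattice homomorphisms separate the points of a principal ideal,
   so that an inequality between lattice-linear expressions only has to be
   checked for real numbers. *)
Theorem lattice_hom_separates u w : vle 0 u -> ideal u w -> ~~ vle w 0 ->
  exists f : X -> R,
    [/\ forall a x y, ideal u x -> ideal u y -> f (a *: x + y) = a * f x + f y,
        forall x y, ideal u x -> ideal u y ->
          f (vjoin x y) = Num.max (f x) (f y) &
        0 < f w].
Proof.
move=> u0 iw w0; have u_neq0 : u != 0.
  apply: contraNneq w0 => u00; move: iw => [c]; rewrite u00 scaler0.
  by apply: vle_trans; exact: vle_modulus.
pose J x y z := [/\ ideal u x, ideal u y & z = vjoin x y].
have [| | | |f [fl _ fw fJ]] := sublinear_dominates _ _ _ _
  (gauge_sublinear u0 u_neq0) iw.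
- by move=> x y; exact: idealD.
- by move=> a x; exact: idealZ.
- by move=> x y _ [ix iy ->]; split=> //; exact: idealJ.
- move=> t x y _ it [ix iy ->]; split; [exact: idealD|exact: idealD|].
  by rewrite vjoinDr.
exists f; split=> // [x y ix iy|]; first exact: fJ.
by rewrite fw ltNge gauge_le// scale0r.
Qed.

End vector_lattice.

(** * Random signs, random weights and truncation on the real line *)

Section random_signs.
Context {R : realType} {n : nat}.
Implicit Types (a : 'I_n -> R) (e : {ffun 'I_n -> bool}).
Implicit Types (th : {ffun 'I_n -> 'I_n}).

Definition rsign e k : R := (-1) ^+ e k.

Definition flip k e : {ffun 'I_n -> bool} :=
  [ffun j => if j == k then ~~ e j else e j].

Lemma flipK k : involutive (flip k).
Proof.
by move=> e; apply/ffunP => j; rewrite !ffunE; case: eqP => //; rewrite negbK.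
Qed.

Lemma rsign_flip k e j :
  rsign (flip k e) j = if j == k then - rsign e j else rsign e j.
Proof. by rewrite /rsign ffunE; case: eqP => // _; rewrite signrN. Qed.

Lemma rsign_sqr e k : rsign e k * rsign e k = 1.
Proof. by rewrite /rsign -expr2 sqrr_sign. Qed.

Lemma rsign_norm e k : `|rsign e k| = 1.
Proof. exact: normr_sign. Qed.

Definition rsum a e : R := \sum_j rsign e j * a j.

Lemma rsum_flip a k e : rsum a (flip k e) = rsum a e - 2 * (rsign e k * a k).
Proof.
rewrite /rsum (bigD1 k)//= [in RHS](bigD1 k)//= rsign_flip eqxx.
rewrite [X in _ + X = _](_ : _ = \sum_(i < n | i != k) rsign e i * a i).
  ring.
by apply: eq_bigr => i /negbTE ik; rewrite rsign_flip ik.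
Qed.

(** Signs are orthogonal: for [j != l], flipping the sign [j] negates the sum of
    [rsign e j * rsign e l] over [e]. *)
Lemma rsum_second_moment a :
  \sum_e rsum a e ^+ 2 = #|{ffun 'I_n -> bool}|%:R * \sum_j a j ^+ 2.
Proof.
have E j l : \sum_e rsign e j * rsign e l =
    #|{ffun 'I_n -> bool}|%:R * (j == l)%:R.
  case: (altP eqP) => [->|jl].
    by under eq_bigr do rewrite rsign_sqr; rewrite sumr_const mulr1.
  rewrite mulr0; set S := LHS.
  suff : S = - S by lra.
  rewrite {1}/S (reindex_inj (inv_inj (flipK j))) -sumrN; apply: eq_bigr => e _.
  by rewrite !rsign_flip eqxx eq_sym (negbTE jl) mulNr.
transitivity (\sum_j \sum_l a j * a l * \sum_e rsign e j * rsign e l).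
  under eq_bigr do rewrite expr2 /rsum big_distrlr /=.
  rewrite exchange_big /=; apply: eq_bigr => j _.
  rewrite exchange_big /=; apply: eq_bigr => l _.
  by rewrite mulr_sumr; apply: eq_bigr => e _; ring.
rewrite mulr_sumr; apply: eq_bigr => j _.
under eq_bigr do rewrite E.
rewrite (bigD1 j)//= eqxx big1 ?addr0 => [|l lj].
  by rewrite mulr1 mulrC expr2.
by rewrite eq_sym (negbTE lj) !mulr0.
Qed.

Lemma sum_indicator_gt (c : R) (N : nat) : 0 <= c ->
  \sum_(m < N) (c < m.+1%:R)%R%:R <= Num.max 0 (N%:R - c + 1).
Proof.
move=> c0; elim: N => [|N IH]; first by rewrite big_ord0 le_max lexx.
rewrite big_ord_recr /=; move: IH; set S := \sum_(_ < _) _.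
rewrite !le_max -[N.+1%:R]natr1 => /orP IH.
by case: (ltP c (N%:R + 1)) => h; apply/orP; [right|left]; case: IH;
  rewrite /= ?addr0; lra.
Qed.

Hypothesis n_gt0 : (0 < n)%N.

Let n0 : 0 < n%:R :> R. Proof. by rewrite ltr0n. Qed.

(* Under the uniform law of [m], the square of [weight m] has the tail
   [P (weight m ^+ 2 >= s) ~ s^-1] of a Frechet variable of index 2. *)
Definition weight (m : 'I_n) : R := Num.sqrt (n%:R / m.+1%:R).

(** The event says that [weight (th k) * |a k|] is below half of [Num.sqrt s2] for all [k]. By
    independence its probability is at most the product of the [1 + 1/n - 4 a_k^2 / s2], hence at
    most [exp (1 - 4) <= 1/8]. *)
Lemma weight_max_small a (s2 : R) : s2 = \sum_j a j ^+ 2 -> 0 < s2 ->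
  8 * \sum_(th : {ffun 'I_n -> 'I_n})
      \prod_k (4 * n%:R * a k ^+ 2 < (th k).+1%:R * s2)%R%:R
    <= #|{ffun 'I_n -> 'I_n}|%:R :> R.
Proof.
move=> s2E s2_gt0.
have expR3 : 8 <= expR 3 :> R.
  have -> : 3 = 3 * 1 :> R by rewrite mulr1.
  rewrite expRM_natl; have := expR_ge1Dx (1 : R).
  set e := expR 1 => e2.
  have : 2 ^+ 3 <= e ^+ 3 by rewrite lerXn2r ?nnegrE; lra.
  by rewrite (_ : 2 ^+ 3 = 8 :> R)//; ring.
rewrite -(bigA_distr_bigA
  (fun k m : 'I_n => (4 * n%:R * a k ^+ 2 < m.+1%:R * s2)%R%:R)) /=.
rewrite card_ffun card_ord natrX.
apply: (@le_trans _ _ (8 * \prod_(k < n)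
    (n%:R * expR (n%:R^-1 - 4 * (a k ^+ 2 / s2))))).
  rewrite ler_pM2l//; apply: ler_prod => k _; apply/andP; split.
    by apply: sumr_ge0 => m _; exact: ler0n.
  have c0 : 0 <= 4 * n%:R * a k ^+ 2 / s2.
    by apply: divr_ge0; [rewrite mulr_ge0 ?sqr_ge0// mulr_ge0|exact: ltW].
  under eq_bigr do rewrite -ltr_pdivrMr//.
  apply: le_trans (sum_indicator_gt n c0) _; rewrite ge_max; apply/andP; split.
    by rewrite mulr_ge0 ?expR_ge0// ltW.
  apply: le_trans (ler_wpM2l (ltW n0) (expR_ge1Dx _)).
  rewrite le_eqVlt; apply/orP; left; apply/eqP; field.
  by rewrite !gt_eqF.
rewrite big_split/= prodr_const card_ord -expR_sum.
rewrite big_split/= sumr_const card_ord -[_^-1 *+ n]mulr_natr mulVf ?gt_eqF//.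
rewrite sumrN -mulr_sumr -mulr_suml -s2E divff ?gt_eqF//.
rewrite (_ : 1 - 4 * 1 = - 3); last ring.
rewrite mulrCA ger_pMr ?exprn_gt0// expRN.
by rewrite ler_pdivrMr ?expR_gt0// mul1r.
Qed.

(** Truncation to [[-v, v]] for [v >= 0], written with joins and opposites only so that
    homomorphisms carry [vclip] to it. *)
Definition clip (s v : R) : R := Num.max (- Num.max (- s) (- v)) (- v).

Lemma clipP s v : 0 <= v -> [\/ s <= - v /\ clip s v = - v,
  - v <= s <= v /\ clip s v = s | v <= s /\ clip s v = v].
Proof.
move=> v0; rewrite /clip; have [vs|sv] := leP (- s) (- v).
  by rewrite opprK max_l; [constructor 3; split=> //; lra|lra].
rewrite opprK; have [h|h] := leP s (- v).
  by constructor 1.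
by constructor 2; split=> //; apply/andP; split; lra.
Qed.

Lemma clip_id s v : `|s| <= v -> clip s v = s.
Proof.
move=> sv; have /clipP cl : 0 <= v by exact: le_trans sv.
by move: sv; rewrite ler_norml => /andP[]; case: (cl s) => -[h ->]; lra.
Qed.

(** What truncation removes, [s - clip s v], is a soft threshold of [s], which is 1-Lipschitz. *)
Lemma clip_contract s s' v : 0 <= v ->
  `|(s - s') - (clip s v - clip s' v)| <= `|s - s'|.
Proof.
move=> v0; rewrite ler_norml.
have [] := clipP s v0 => -[h ->]; have [] := clipP s' v0 => -[h' ->];
  by case: (ler0P (s - s')) => ?; apply/andP; split; lra.
Qed.

(** With [s] the square root of [s2], either [u < 3 s], which makes all weighted terms smaller than
    [s / 2] and has probability at most 1/8, or the random sum exceeds [3 s], with probability at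
    most 1/9 by Chebyshev. The total is below 1/4. *)
Lemma rsum_exceeds a (u : {ffun 'I_n -> 'I_n} -> R) :
  (forall th j, 6 * `|weight (th j) * a j| <= u th) ->
  4 * \sum_(w : {ffun 'I_n -> bool} * {ffun 'I_n -> 'I_n})
     (u w.2 < `|rsum a w.1|)%R%:R
    <= #|{: {ffun 'I_n -> bool} * {ffun 'I_n -> 'I_n}}|%:R :> R.
Proof.
move=> hu; set s2 := \sum_j a j ^+ 2.
have u0 th : 0 <= u th.
  by apply: le_trans (hu th (Ordinal n_gt0)); rewrite mulr_ge0.
have [s20|] := eqVneq s2 0.
  have a0 j : a j = 0.
    move/eqP: s20; rewrite psumr_eq0 => [|i _]; last exact: sqr_ge0.
    move=> /allP /(_ j (mem_index_enum j)) /=.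
    by rewrite sqrf_eq0 => /eqP.
  rewrite big1 ?mulr0// => w _; rewrite /rsum big1 ?normr0 => [|j _].
    by rewrite ltNge u0.
  by rewrite a0 mulr0.
move=> s2_neq0; have s2_gt0 : 0 < s2.
  by rewrite lt0r s2_neq0; apply: sumr_ge0 => j _; exact: sqr_ge0.
(* [F] is the Chebyshev bound; [G] is the indicator of the event of [weight_max_small]. *)
pose F e : R := rsum a e ^+ 2 / (9 * s2).
pose G (th : {ffun 'I_n -> 'I_n}) : R :=
  \prod_k (4 * n%:R * a k ^+ 2 < (th k).+1%:R * s2)%R%:R.
have FG e th : (u th < `|rsum a e|)%R%:R <= F e + G th.
  have F0 : 0 <= F e by rewrite divr_ge0 ?sqr_ge0// mulr_ge0// ltW.
  have G0 : 0 <= G th by apply: prodr_ge0 => k _; exact: ler0n.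
  case: (ltP (u th) `|rsum a e|) => [ue|_]; last by rewrite addr_ge0.
  have [u_small|u_large] := ltP (u th ^+ 2) (9 * s2).
    rewrite /G big1 ?lerDr// => k _.
    suff -> : 4 * n%:R * a k ^+ 2 < (th k).+1%:R * s2 by [].
    have m0 : 0 < (th k).+1%:R :> R by rewrite ltr0n.
    have : (6 * `|weight (th k) * a k|) ^+ 2 < 9 * s2.
      by apply: le_lt_trans u_small; rewrite lerXn2r ?nnegrE ?u0.
    rewrite exprMn real_normK ?num_real// exprMn sqr_sqrtr; last first.
      by rewrite divr_ge0// ltW.
    rewrite -(ltr_pM2l m0).
    rewrite [X in X < _ -> _](_ : _ = 9 * (4 * n%:R * a k ^+ 2)).
      rewrite [X in _ < X -> _](_ : _ = 9 * ((th k).+1%:R * s2)); last ring.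
      by rewrite ltr_pM2l.
    by field; rewrite gt_eqF.
  rewrite -[leLHS]addr0 lerD// ler_pdivlMr ?mulr_gt0// mul1r.
  apply: le_trans u_large _; rewrite -[leRHS]real_normK ?num_real//.
  by rewrite lerXn2r ?nnegrE ?u0// ltW.
rewrite card_prod natrM.
rewrite -(pair_bigA _ (fun e th => (u th < `|rsum a e|)%R%:R)) /=.
apply: (@le_trans _ _ (4 * \sum_e \sum_th (F e + G th))).
  by rewrite ler_pM2l//; apply: ler_sum => e _; apply: ler_sum => th _.
have -> : \sum_e \sum_th (F e + G th) =
    #|{ffun 'I_n -> 'I_n}|%:R * \sum_e F e +
    #|{ffun 'I_n -> bool}|%:R * \sum_th G th.
  under eq_bigr do rewrite big_split/= sumr_const -[_ *+ _]mulr_natl.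
  by rewrite big_split/= sumr_const -mulr_sumr -[X in _ + X = _]mulr_natl.
rewrite -mulr_suml rsum_second_moment -/s2.
have := weight_max_small erefl s2_gt0; rewrite -/G.
set N := #|{ffun 'I_n -> 'I_n}|%:R; set M := #|{ffun 'I_n -> bool}|%:R.
set g := \sum_th _ => hg.
have M0 : 0 <= M by exact: ler0n.
have N0 : 0 <= N by exact: ler0n.
rewrite (_ : M * s2 / (9 * s2) = M / 9); last by field; rewrite gt_eqF.
nra.
Qed.

(* Flipping the sign [e k] changes the sum by [2 a k] and, outside of the event
   where one of the two sums is truncated, changes its truncation as much. *)
Lemma clip_average a (u : {ffun 'I_n -> 'I_n} -> R) k :
  (forall th j, 6 * `|weight (th j) * a j| <= u th) ->
  `|a k - #|{: {ffun 'I_n -> bool} * {ffun 'I_n -> 'I_n}}|%:R^-1 *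
     \sum_(w : {ffun 'I_n -> bool} * {ffun 'I_n -> 'I_n})
       rsign w.1 k * clip (rsum a w.1) (u w.2)| <= 2^-1 * `|a k|.
Proof.
move=> hu; have := rsum_exceeds hu.
have u0 th : 0 <= u th.
  by apply: le_trans (hu th (Ordinal n_gt0)); rewrite mulr_ge0.
pose W := ({ffun 'I_n -> bool} * {ffun 'I_n -> 'I_n})%type.
pose fl (w : W) : W := (flip k w.1, w.2).
have flI : injective fl by apply: inv_inj => -[e th]; rewrite /fl /= flipK.
pose B (w : W) : R := (u w.2 < `|rsum a w.1|)%R%:R.
pose Y (w : W) : R := rsign w.1 k * clip (rsum a w.1) (u w.2).
rewrite -/W; set N := #|_|%:R; rewrite -/(\sum_w B w) -/(\sum_w Y w) => hB.
have N0 : 0 < N.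
  rewrite ltr0n; apply/card_gt0P.
  by exists ([ffun=> true], [ffun=> Ordinal n_gt0]).
have diff w : `|2 * a k - (Y w + Y (fl w))| <= 2 * `|a k| * (B w + B (fl w)).
  have -> : 2 * a k - (Y w + Y (fl w)) = rsign w.1 k *
      ((rsum a w.1 - rsum a (flip k w.1)) -
       (clip (rsum a w.1) (u w.2) - clip (rsum a (flip k w.1)) (u w.2))).
    rewrite /Y /= rsign_flip eqxx [in X in _ = _ * (X - _)]rsum_flip.
    have := rsign_sqr w.1 k; set s := rsign _ _ => ss.
    transitivity ((s * s) * (2 * a k) -
      (s * clip (rsum a w.1) (u w.2) +
       - s * clip (rsum a (flip k w.1)) (u w.2))).
      by rewrite ss mul1r.
    ring.
  rewrite normrM rsign_norm mul1r /B /=.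
  have := clip_contract (rsum a w.1) (rsum a (flip k w.1)) (u0 w.2).
  have -> : `|rsum a w.1 - rsum a (flip k w.1)| = 2 * `|a k|.
    by rewrite rsum_flip opprB addrC subrK !normrM rsign_norm mul1r normr_nat.
  have ak0 := normr_ge0 (a k).
  case: ltP => h1; case: ltP => h2 h /=; try lra.
  by rewrite !clip_id// subrr normr0 addr0 mulr0.
have SY : \sum_w Y (fl w) = \sum_w Y w by rewrite [RHS](reindex_inj flI).
have SB : \sum_w B (fl w) = \sum_w B w by rewrite [RHS](reindex_inj flI).
(* After division by [2 * N] the error is at most [2 * |a k|] times the probability of truncation,
   which is at most 1/4. *)
have S : `|2 * N * a k - 2 * \sum_w Y w| <= 4 * `|a k| * \sum_w B w.
  have -> : 2 * N * a k - 2 * \sum_w Y w = \sum_w (2 * a k - (Y w + Y (fl w))).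
    rewrite sumrB big_split/= SY sumr_const -[_ *+ _]mulr_natl -/N; ring.
  apply: le_trans (ler_norm_sum _ _ _) _.
  apply: le_trans (ler_sum _ (fun w _ => diff w)) _.
  by rewrite -mulr_sumr big_split/= SB; lra.
have -> : a k - N^-1 * \sum_w Y w = (2 * N)^-1 * (2 * N * a k - 2 * \sum_w Y w).
  by field; rewrite gt_eqF.
rewrite normrM gtr0_norm ?invr_gt0 ?mulr_gt0// mulrC ler_pdivrMr ?mulr_gt0//.
apply: le_trans S _; have := ler_wpM2l (normr_ge0 (a k)) hB; lra.
Qed.

End random_signs.

(** * Moments of the weights *)

Section weight_moments.
Context {R : realType}.

(** Weighted arithmetic-geometric mean inequality for 1 and [x]. The tangent to [exp] at [s * ln x]
    is evaluated at 0 and at [ln x], and combined with weights [1 - s] and [s], which cancels the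
    linear terms. *)
Lemma powR_le_affine (x s : R) : 0 <= x -> 0 < s -> s <= 1 ->
  x `^ s <= 1 - s + s * x.
Proof.
rewrite le_eqVlt => /predU1P[<- s0 s1|x0 s0 s1].
  by rewrite powR0 ?gt_eqF// mulr0 addr0 subr_ge0.
rewrite /powR gt_eqF//; set y := s * ln x; set E := expR y.
have E0 : 0 < E by exact: expR_gt0.
have h1 : E * (1 + (0 - y)) <= 1.
  have := ler_wpM2l (ltW E0) (expR_ge1Dx (0 - y)).
  by rewrite -expRD [y + _]addrC subrK expR0.
have h2 : E * (1 + (ln x - y)) <= x.
  have := ler_wpM2l (ltW E0) (expR_ge1Dx (ln x - y)).
  by rewrite -expRD [y + _]addrC subrK lnK.
have h1' : (1 - s) * (E * (1 + (0 - y))) <= (1 - s) * 1.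
  by apply: ler_wpM2l => //; rewrite subr_ge0.
have h2' := ler_wpM2l (ltW s0) h2.
suff : E = (1 - s) * (E * (1 + (0 - y))) + s * (E * (1 + (ln x - y))) by lra.
by rewrite /y; ring.
Qed.

(** Comparison with an integral, done by induction: the increment from [N] to [N.+1] is
    [powR_le_affine] at [x = N / N.+1]. *)
Lemma sum_powR_le (r : R) (N : nat) : 0 < r -> r < 1 ->
  \sum_(m < N) m.+1%:R `^ (- r) <= N%:R `^ (1 - r) / (1 - r).
Proof.
move=> r0 r1; have s0 : 0 < 1 - r by rewrite subr_gt0.
elim: N => [|N IH]; first by rewrite big_ord0 divr_ge0 ?powR_ge0// ltW.
rewrite big_ord_recr /=; apply: le_trans (lerD IH (lexx _)) _.
set M : R := N.+1%:R; have M0 : 0 < M by rewrite ltr0n.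
have -> : N%:R `^ (1 - r) = (N%:R / M) `^ (1 - r) * M `^ (1 - r).
  by rewrite -powRM ?divr_ge0 ?ler0n// ?ltW// divfK// gt_eqF.
have MN : M - N%:R = 1 by rewrite /M -natr1 addrC addKr.
have -> : M `^ (- r) = (1 - N%:R / M) * M `^ (1 - r).
  rewrite powRD; last by rewrite gt_eqF// implybT.
  rewrite powRr1 ?ltW// mulrA mulrBl divfK ?gt_eqF//.
  by rewrite mul1r MN mul1r.
have x0 : 0 <= N%:R / M by rewrite divr_ge0// ltW.
have s1 : 1 - r <= 1 by rewrite gerBl ltW.
have := powR_le_affine x0 s0 s1; set x := N%:R / M; set s := 1 - r => h.
set P := M `^ s; have P0 : 0 <= P by exact: powR_ge0.
rewrite -subr_ge0 (_ : _ - _ = P * ((1 - s + s * x - x `^ s) / s)).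
  by rewrite mulr_ge0// divr_ge0 ?(ltW s0)// subr_ge0.
by field; rewrite gt_eqF.
Qed.

Lemma weight_moment (n : nat) (p : R) : 0 < p -> p < 2 ->
  \sum_(m < n) weight m `^ p <= n%:R / (1 - p / 2).
Proof.
move=> p0 p2; have r0 : 0 < p / 2 by rewrite divr_gt0.
have r1 : p / 2 < 1 by rewrite ltr_pdivrMr// mul1r.
rewrite (eq_bigr (fun m : 'I_n =>
  n%:R `^ (p / 2) * m.+1%:R `^ (- (p / 2)))) => [|m _]; last first.
  rewrite /weight -powR12_sqrt ?divr_ge0// -powRrM [2^-1 * p]mulrC.
  by rewrite powRM// ?invr_ge0// -[m.+1%:R^-1]powR_inv1// -powRrM mulN1r.
rewrite -mulr_sumr.
apply: le_trans (ler_wpM2l (powR_ge0 _ _) (sum_powR_le n r0 r1)) _.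
rewrite mulrA -powRD; last by rewrite addrC subrK oner_eq0.
by rewrite addrC subrK powRr1.
Qed.

End weight_moments.

(** * Calculus of a join-preserving linear functional on a principal ideal *)

Section lattice_hom.
Context {R : realType} {X : banachLatticeType R}.
Variables (u : X) (f : X -> R).
Hypothesis f_lin : forall a x y, ideal u x -> ideal u y ->
  f (a *: x + y) = a * f x + f y.
Hypothesis f_join : forall x y, ideal u x -> ideal u y ->
  f (vjoin x y) = Num.max (f x) (f y).
Implicit Types (x y : X).

Lemma hom0 : f 0 = 0.
Proof.
have := f_lin 1 (ideal0 u) (ideal0 u); rewrite scaler0 addr0; lra.
Qed.

Lemma homD x y : ideal u x -> ideal u y -> f (x + y) = f x + f y.
Proof. by move=> ix iy; rewrite -{1}[x]scale1r f_lin// mul1r. Qed.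

Lemma homZ a x : ideal u x -> f (a *: x) = a * f x.
Proof.
by move=> ix; rewrite -[a *: x]addr0 f_lin ?hom0 ?addr0//; exact: ideal0.
Qed.

Lemma homN x : ideal u x -> f (- x) = - f x.
Proof. by move=> ix; rewrite -scaleN1r homZ// mulN1r. Qed.

Lemma hom_sum (I : Type) (r : seq I) (F : I -> X) :
  (forall i, ideal u (F i)) -> f (\sum_(i <- r) F i) = \sum_(i <- r) f (F i).
Proof.
move=> h; elim: r => [|i r IH]; first by rewrite !big_nil hom0.
by rewrite !big_cons homD ?IH//; exact: ideal_sum.
Qed.

Lemma hom_mono x y : ideal u x -> ideal u y -> vle x y -> f x <= f y.
Proof.
move=> ix iy xy; have -> : y = vjoin x y.
  apply: vle_eq; first exact: vjoin_ubr.
  by apply: vjoin_lub => //; exact: vle_refl.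
by rewrite f_join// le_max lexx.
Qed.

Lemma hom_modulus x : ideal u x -> f (modulus x) = `|f x|.
Proof.
by move=> ix; rewrite f_join ?homN//; [rewrite -maxrN|exact: idealN].
Qed.

End lattice_hom.

(** * Approximation in the lattice with remainder at most one half *)

Section halving.
Context {R : realType} {X : banachLatticeType R} {n : nat}.
Hypothesis n_gt0 : (0 < n)%N.
Variable x : 'I_n -> X.

Let outcome := ({ffun 'I_n -> bool} * {ffun 'I_n -> 'I_n})%type.

Definition vrsum (e : {ffun 'I_n -> bool}) : X := \sum_j rsign e j *: x j.

(** The factor 6 is the one that [clip_average] asks of the truncation level. *)
Definition bound (th : {ffun 'I_n -> 'I_n}) : X :=
  6 *: \big[vjoin/0]_(j < n) modulus (weight (th j) *: x j).

(* [(s /\ v) \/ - v], without meets because the homomorphisms at hand are only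
   known to preserve joins. *)
Definition vclip (s v : X) : X := vjoin (- vjoin (- s) (- v)) (- v).

Definition truncated (w : outcome) : X := vclip (vrsum w.1) (bound w.2).

Definition remainder k : X :=
  x k - #|{: outcome}|%:R^-1 *: \sum_(w : outcome) rsign w.1 k *: truncated w.

Lemma bound_ge0 th : vle 0 (bound th).
Proof. by apply: vscaler_ge0 => //; exact: bigjoin_ge0. Qed.

Lemma norm_truncated w : `|truncated w| <= `|bound w.2|.
Proof.
have b0 := bound_ge0 w.2; apply: norm_vle.
  apply: vjoin_lub; last first.
    by apply: (vle_trans _ b0); apply: vleNl; rewrite oppr0.
  by apply: vleNl; exact: vjoin_ubr.
by apply: vleNl; exact: vjoin_ubr.
Qed.

(** If this failed, some lattice homomorphism [f] would be positive on [remainder k] or its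
    opposite, less half the modulus of [x k]. That contradicts [clip_average] for the reals
    [f (x j)]. *)
Lemma modulus_remainder k : vle (modulus (remainder k)) (2^-1 *: modulus (x k)).
Proof.
(* The ideal of this [u] contains every vector built from the [x j] below. *)
pose u := \sum_j modulus (x j).
have sum_ge0 (P : pred 'I_n) : vle 0 (\sum_(j | P j) modulus (x j)).
  elim/big_rec : _ => [|j y _ y0]; first exact: vle_refl.
  by apply: vaddr_ge0 => //; exact: modulus_ge0.
have u0 : vle 0 u by exact: sum_ge0.
have ix j : ideal u (x j).
  exists 1; rewrite scale1r /u (bigD1 j)//= -[modulus (x j)]addr0 -addrA add0r.
  by apply: vleD; [exact: vle_refl|exact: sum_ge0].
have im y : ideal u y -> ideal u (modulus y).
  by move=> iy; apply: idealJ => //; exact: idealN.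
have iS e : ideal u (vrsum e) by apply: ideal_sum => j; exact: idealZ.
have iU th : ideal u (bound th).
  by apply/idealZ/ideal_bigjoin => j; apply/im/idealZ.
have iY w : ideal u (truncated w).
  by apply: idealJ; apply: idealN => //; apply: idealJ; exact: idealN.
have isY w : ideal u (rsign w.1 k *: truncated w) by exact: idealZ.
have iZ : ideal u (\sum_(w : outcome) rsign w.1 k *: truncated w).
  exact: ideal_sum.
have ir : ideal u (remainder k) by apply: idealD => //; apply/idealN/idealZ.
have real_bound f :
    (forall a y z, ideal u y -> ideal u z -> f (a *: y + z) = a * f y + f z) ->
    (forall y z, ideal u y -> ideal u z ->
      f (vjoin y z) = Num.max (f y) (f z)) ->
    `|f (remainder k)| <= 2^-1 * `|f (x k)| :> R.
  move=> fl fj; have fN := homN fl; have fZ := homZ fl.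
  rewrite (homD fl)//; last exact/idealN/idealZ.
  rewrite fN ?fZ//; last exact: idealZ.
  rewrite (hom_sum fl)//.
  under eq_bigr => w _.
    rewrite fZ// /truncated /vclip fj; last 2 first.
    - by apply/idealN/idealJ; exact: idealN.
    - exact: idealN.
    rewrite fN; last by apply: idealJ; exact: idealN.
    rewrite fj; [|exact: idealN..].
    rewrite !fN// /vrsum (hom_sum fl); last by move=> j; exact: idealZ.
    under eq_bigr do rewrite fZ//.
    rewrite -/(rsum (fun j => f (x j)) w.1) -/(clip _ (f (bound w.2))).
    over.
  apply: (clip_average n_gt0 (a := fun j => f (x j))
    (u := fun th => f (bound th))).
  move=> th j.
  rewrite -fZ// -(hom_modulus fl fj); last exact: idealZ.
  rewrite -fZ; last exact/im/idealZ.
  apply: (hom_mono fj) => //; first exact/idealZ/im/idealZ.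
  apply: vleZ2l => //.
  exact: (vle_bigjoin (fun i => modulus (weight (th i) *: x i))
    (mem_index_enum j)).
apply: modulus_lub; apply: contraT => h.
- have iw : ideal u (remainder k - 2^-1 *: modulus (x k)).
    by apply: idealD => //; apply/idealN/idealZ/im.
  rewrite -subv_le0 in h.
  have [f [fl fj]] := lattice_hom_separates u0 iw h.
  rewrite (homD fl) ?(homN fl) ?(homZ fl) ?(hom_modulus fl fj)//;
    [|exact/im|exact/idealZ/im|exact/idealN/idealZ/im].
  have := real_bound f fl fj; have := ler_norm (f (remainder k)); lra.
- have iw : ideal u (- remainder k - 2^-1 *: modulus (x k)).
    by apply: idealD; [exact: idealN|apply/idealN/idealZ/im].
  rewrite -subv_le0 in h.
  have [f [fl fj]] := lattice_hom_separates u0 iw h.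
  rewrite (homD fl) ?(homN fl) ?(homZ fl) ?(hom_modulus fl fj)//;
    [|exact/im|exact/idealZ/im|exact/idealN|exact/idealN/idealZ/im].
  have := real_bound f fl fj; have := ler_norm (- f (remainder k)).
  rewrite normrN; lra.
Qed.

Lemma norm_remainder k : `|remainder k| <= 2^-1 * `|x k|.
Proof.
have h : 0 <= 2^-1 :> R by rewrite invr_ge0.
rewrite -(ger0_norm h) -(norm_modulus (x k)) -normrZ.
have m := modulus_remainder k; apply: norm_vle; apply: vle_trans m.
  exact: vle_modulus.
exact: vleN_modulus.
Qed.

End halving.

(** * Averages over independent weights *)

Section marginals.
Context {R : realType} {n : nat}.
Hypothesis n_gt0 : (0 < n)%N.

(** Each coordinate of [th] is uniform: padding [F (th j)] with factors 1 at the other coordinates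
    lets the sum factor. *)
Lemma sum_marginal (j : 'I_n) (F : 'I_n -> R) :
  n%:R * \sum_(th : {ffun 'I_n -> 'I_n}) F (th j) =
  #|{ffun 'I_n -> 'I_n}|%:R * \sum_m F m.
Proof.
pose G (i m : 'I_n) := if i == j then F m else 1.
have -> : \sum_(th : {ffun 'I_n -> 'I_n}) F (th j) =
    \sum_(th : {ffun 'I_n -> 'I_n}) \prod_i G i (th i).
  apply: eq_bigr => th _; rewrite (bigD1 j)//= big1 /G ?eqxx ?mulr1//.
  by move=> i /negbTE ->.
rewrite -bigA_distr_bigA /= (bigD1 j)//= /G eqxx.
rewrite [X in _ * (_ * X)](eq_bigr (fun=> n%:R)) => [|i /negbTE ->]; last first.
  by rewrite sumr_const card_ord.
rewrite mulrCA mulrC; congr (_ * _).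
by rewrite card_ffun natrX -prodr_const [RHS](bigD1 j)//= card_ord.
Qed.

(** The root is made linear by [(Z / B)^(1/p) <= 1 + Z / B], with [B] the sum of the [b j];
    [weight_moment] then bounds the average of [Z]. *)
Lemma average_weighted_lp (p : R) (b : 'I_n -> R) : 1 < p -> p < 2 ->
  (forall j, 0 <= b j) ->
  \sum_(th : {ffun 'I_n -> 'I_n}) (\sum_j weight (th j) `^ p * b j) `^ p^-1
    <= #|{ffun 'I_n -> 'I_n}|%:R *
       ((1 + (1 - p / 2)^-1) * (\sum_j b j) `^ p^-1).
Proof.
move=> p1 p2 b0; have p0 : 0 < p by lra.
have ip0 : 0 < p^-1 by rewrite invr_gt0.
have ip1 : p^-1 <= 1 by rewrite invf_le1// ltW.
have M0 : 0 < 1 - p / 2 by lra.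
set B := \sum_j b j.
have [B0|] := eqVneq B 0.
  rewrite B0 powR0 ?gt_eqF// !mulr0 big1// => th _.
  rewrite big1 ?powR0 ?gt_eqF// => j _.
  move/eqP: B0; rewrite psumr_eq0// => /allP /(_ j (mem_index_enum j)) /eqP ->.
  by rewrite mulr0.
move=> B_neq0; have B_gt0 : 0 < B by rewrite lt0r B_neq0; exact: sumr_ge0.
pose Z (th : {ffun 'I_n -> 'I_n}) := \sum_j weight (th j) `^ p * b j.
have Z0 th : 0 <= Z th by apply: sumr_ge0 => j _; rewrite mulr_ge0 ?powR_ge0.
apply: (@le_trans _ _ (\sum_th (1 + Z th / B) * B `^ p^-1)).
  apply: ler_sum => th _; rewrite -/(Z th).
  rewrite -[X in X `^ _](divfK B_neq0) powRM ?divr_ge0 ?(ltW B_gt0)//.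
  rewrite ler_wpM2r ?powR_ge0//.
  have ZB : 0 <= Z th / B by rewrite divr_ge0 ?(ltW B_gt0).
  by apply: le_trans (powR_le_affine ZB ip0 ip1) _; nra.
rewrite -mulr_suml mulrA ler_wpM2r ?powR_ge0//.
rewrite big_split/= sumr_const mulrDr mulr1 lerD2l -mulr_suml ler_pdivrMr//.
rewrite exchange_big /= -mulrA mulr_sumr mulr_sumr ler_sum// => j _.
rewrite -mulr_suml !mulrA ler_wpM2r//.
have n0 : 0 < n%:R :> R by rewrite ltr0n.
rewrite -(ler_pM2l n0) (sum_marginal j (fun m => weight m `^ p)) mulrCA.
by rewrite ler_wpM2l// weight_moment.
Qed.

End marginals.

(** * Trace estimate for operators into the space [ell1] under an upper estimate *)

Section l1_operators.
Context {R : realType} {X : banachLatticeType R}.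
Variables (p C0 : R).
Hypotheses (p1 : 1 < p) (p2 : p < 2) (C0_ge0 : 0 <= C0).
Hypothesis upX : forall n (x : 'I_n -> X),
  `|\big[vjoin/0]_(k < n) modulus (x k)|
    <= C0 * (\sum_(k < n) `|x k| `^ p) `^ p^-1.

Let p0 : 0 < p. Proof. by apply: lt_trans p1. Qed.

(** Controls the average norm of [bound]: 6 comes from its definition, [C0] from the upper estimate,
    the rest from [average_weighted_lp]. *)
Let M : R := 6 * C0 * (1 + (1 - p / 2)^-1).

Let M_ge0 : 0 <= M.
Proof.
rewrite /M mulr_ge0 ?mulr_ge0// addr_ge0// invr_ge0.
by rewrite subr_ge0 ler_pdivrMr// mul1r ltW.
Qed.

Section operator.
Variables (n : nat) (g : 'I_n -> X -> R) (K : R).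
Hypothesis n_gt0 : (0 < n)%N.
Hypothesis g_lin : forall k a x y, g k (a *: x + y) = a * g k x + g k y.
Hypothesis K_ge0 : 0 <= K.
Hypothesis g_bound : forall z, \sum_k `|g k z| <= K * `|z|.

Let g0 k : g k 0 = 0.
Proof. by have := g_lin k 1 0 0; rewrite scaler0 addr0; lra. Qed.

Let gD k x y : g k (x + y) = g k x + g k y.
Proof. by rewrite -{1}[x]scale1r g_lin mul1r. Qed.

Let gZ k a x : g k (a *: x) = a * g k x.
Proof. by rewrite -[a *: x]addr0 g_lin g0 addr0. Qed.

Let g_sum k (I : Type) (r : seq I) (F : I -> X) :
  g k (\sum_(i <- r) F i) = \sum_(i <- r) g k (F i).
Proof.
by elim: r => [|i r IH]; rewrite ?big_nil ?g0// !big_cons gD IH.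
Qed.

Let W := ({ffun 'I_n -> bool} * {ffun 'I_n -> 'I_n})%type.

Let lp (x : 'I_n -> X) : R := (\sum_k `|x k| `^ p) `^ p^-1.

(** One truncated vector serves all [k] at a given outcome, so the signed sum of its coordinates
    under [g] is at most [K] times its norm, hence [K] times the norm of [bound]. *)
Lemma trace_step (x : 'I_n -> X) :
  \sum_k g k (x k) <= \sum_k g k (remainder x k) + M * K * lp x.
Proof.
have N0 : 0 < #|{: W}|%:R :> R.
  rewrite ltr0n; apply/card_gt0P.
  by exists ([ffun=> true], [ffun=> Ordinal n_gt0]).
have -> : \sum_k g k (x k) = \sum_k g k (remainder x k) +
    #|{: W}|%:R^-1 * \sum_(w : W) \sum_k rsign w.1 k * g k (truncated x w).
  rewrite exchange_big /= mulr_sumr -big_split/=; apply: eq_bigr => k _.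
  rewrite -[in LHS](subrK (#|{: W}|%:R^-1 *:
    \sum_(w : W) rsign w.1 k *: truncated x w) (x k)).
  rewrite gD gZ g_sum; congr (_ + _ * _); apply: eq_bigr => w _.
  by rewrite gZ.
rewrite lerD2l mulrC ler_pdivrMr//.
have bound_le th : `|bound x th| <=
    6 * (C0 * (\sum_j weight (th j) `^ p * `|x j| `^ p) `^ p^-1).
  rewrite normrZ normr_nat ler_pM2l//.
  apply: le_trans (upX _) _; rewrite (eq_bigr
    (fun j => weight (th j) `^ p * `|x j| `^ p))// => j _.
  by rewrite normrZ ger0_norm ?sqrtr_ge0// powRM// sqrtr_ge0.
have term w : \sum_k rsign w.1 k * g k (truncated x w) <=
    K * (6 * (C0 * (\sum_j weight (w.2 j) `^ p * `|x j| `^ p) `^ p^-1)).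
  apply: (@le_trans _ _ (\sum_k `|g k (truncated x w)|)).
    apply: ler_sum => k _; apply: le_trans (ler_norm _) _.
    by rewrite normrM rsign_norm mul1r.
  apply: le_trans (g_bound _) _; rewrite ler_wpM2l//.
  exact: le_trans (norm_truncated _ _) (bound_le _).
apply: le_trans (ler_sum _ (fun w _ => term w)) _.
rewrite -(pair_bigA _ (fun (e : {ffun 'I_n -> bool})
    (th : {ffun 'I_n -> 'I_n}) =>
  K * (6 * (C0 * (\sum_j weight (th j) `^ p * `|x j| `^ p) `^ p^-1)))) /=.
rewrite sumr_const -!mulr_sumr.
have := average_weighted_lp n_gt0 p1 p2 (fun j => powR_ge0 `|x j| p).
rewrite -/(lp x) card_prod natrM -[_ *+ #|_|]mulr_natl.
set S := \sum_th _; set A := #|{ffun 'I_n -> bool}|%:R.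
set T := #|{ffun 'I_n -> 'I_n}|%:R => h.
have A0 : 0 <= A :> R by exact: ler0n.
have -> : A * (K * (6 * (C0 * S))) = (A * K * 6 * C0) * S by ring.
have -> : M * K * lp x * (A * T) =
    (A * K * 6 * C0) * (T * ((1 + (1 - p / 2)^-1) * lp x)) by rewrite /M; ring.
by rewrite ler_wpM2l// !mulr_ge0.
Qed.

Lemma lp_remainder (x : 'I_n -> X) : lp (remainder x) <= 2^-1 * lp x.
Proof.
have h0 : 0 <= 2^-1 :> R by rewrite invr_ge0.
have h : 2^-1 = ((2^-1 : R) `^ p) `^ p^-1.
  by rewrite -powRrM divff ?gt_eqF// powRr1.
have S0 : 0 <= \sum_k `|x k| `^ p by apply: sumr_ge0 => k _; exact: powR_ge0.
rewrite [in leRHS]h /lp -powRM ?powR_ge0//.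
apply: ge0_ler_powR; rewrite ?nnegrE ?invr_ge0 ?(ltW p0)//.
- by apply: sumr_ge0 => k _; exact: powR_ge0.
- by rewrite mulr_ge0 ?powR_ge0.
rewrite mulr_sumr; apply: ler_sum => k _; rewrite -powRM//.
apply: ge0_ler_powR; rewrite ?nnegrE ?(ltW p0) ?mulr_ge0//.
exact: norm_remainder.
Qed.

(** Each step costs [M * K * lp x] and halves [lp x], so the costs form a geometric series, which
    gives the factor 2. *)
Lemma trace_iterate (m : nat) (x : 'I_n -> X) :
  \sum_k g k (x k) <= 2 * M * K * lp x + K * 2^-1 ^+ m * \sum_k `|x k|.
Proof.
have MK : 0 <= M * K by rewrite mulr_ge0.
elim: m x => [|m IH] x.
  rewrite expr0 mulr1 mulr_sumr -[leLHS]add0r lerD//.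
    by rewrite mulr_ge0 ?powR_ge0// -mulrA mulr_ge0.
  apply: ler_sum => k _; apply: le_trans (g_bound _).
  rewrite (bigD1 k)//=; apply: le_trans (ler_norm _) _.
  by rewrite lerDl sumr_ge0.
apply: le_trans (trace_step x) _.
have r1 : \sum_k `|remainder x k| <= 2^-1 * \sum_k `|x k|.
  by rewrite mulr_sumr; apply: ler_sum => k _; exact: norm_remainder.
have h2 : 0 <= K * 2^-1 ^+ m by rewrite mulr_ge0// exprn_ge0// invr_ge0.
have := ler_wpM2l h2 r1; have := ler_wpM2l MK (lp_remainder x).
have := IH (remainder x); rewrite exprS.
set a := \sum_k g k _; set b := lp (remainder x).
move: (2^-1 ^+ m) => t; move: (\sum_k `|remainder x k|) (\sum_k `|x k|) => s s'.
by move: (lp x) => l; lra.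
Qed.

Lemma trace_le (x : 'I_n -> X) : \sum_k g k (x k) <= 2 * M * K * lp x.
Proof.
apply/ler_addgt0Pl => e e0; rewrite addrC.
set s := K * \sum_k `|x k|.
have s0 : 0 <= s by rewrite mulr_ge0// sumr_ge0.
have [m hm] : exists m, s * 2^-1 ^+ m <= e.
  exists (Num.truncn (s / e)).+1; rewrite exprVn ler_pdivrMr ?exprn_gt0//.
  rewrite mulrC -ler_pdivrMr// -natrX.
  apply: le_trans (ltW (truncnS_gt _)) _.
  by rewrite ler_nat ltnW// ltn_expl.
apply: le_trans (trace_iterate m x) _; rewrite lerD2l.
by apply: le_trans hm; rewrite /s mulrAC.
Qed.

End operator.
End l1_operators.

(** * Functionals norming a finite join *)

Section norming_functionals.
Context {R : realType} {X : banachLatticeType R} {n : nat}.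
Implicit Types (x y z : 'I_n -> X).

Let joinnorm y : R := `|\big[vjoin/0]_(k < n) modulus (y k)|.

Let joinnorm_le y (z : X) : vle 0 z -> (forall k, vle (modulus (y k)) z) ->
  joinnorm y <= `|z|.
Proof.
move=> z0 yz; apply: norm_vle; first by apply: bigjoin_lub => // k _; exact: yz.
apply: (vle_trans _ z0); apply: vleNl; rewrite oppr0; exact: bigjoin_ge0.
Qed.

(** Let [L] be a Hahn-Banach functional on families, below the norm of the join of moduli and equal
    to it at [x]; [f k] is [L] on families supported at [k]. The sum of the [|f k v|] is [L] of a
    family of multiples of [v] by signs or 0, whose join of moduli is at most the modulus of [v]. *)
Lemma norming_functionals x : exists f : 'I_n -> X -> R,
  [/\ forall k a v w, f k (a *: v + w) = a * f k v + f k w,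
      forall v, \sum_k `|f k v| <= `|v| &
      \sum_k f k (x k) = `|\big[vjoin/0]_(k < n) modulus (x k)|].
Proof.
have ub y k : vle (modulus (y k)) (\big[vjoin/0]_(k < n) modulus (y k)).
  exact: (vle_bigjoin (fun i => modulus (y i)) (mem_index_enum k)).
have sN : sublinear setT (fun _ _ _ : 'I_n -> X => False) joinnorm.
  split=> // [y z _ _|a y a0 _].
    apply: le_trans (ler_normD _ _); apply: joinnorm_le => [|k].
      by apply: vaddr_ge0; exact: bigjoin_ge0.
    exact: vle_trans (modulusD _ _) (vleD (ub _ _) (ub _ _)).
  rewrite -{2}(gtr0_norm a0) -normrZ; apply: joinnorm_le => [|k].
    by apply: vscaler_ge0; [exact: ltW|exact: bigjoin_ge0].
  apply: vle_trans (modulusZ_le _ _) _; rewrite gtr0_norm//.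
  by apply: vleZ2l; [exact: ltW|exact: ub].
have [| | | |L [L_lin Lle Lx _]] :=
  sublinear_dominates _ _ _ _ sN (I : setT x); [by []..|].
have {}L_lin a y z : L (a *: y + z) = a * L y + L z by exact: L_lin.
have L0 : L 0 = 0 by have := L_lin 1 0 0; rewrite scaler0 addr0; lra.
have LD y z : L (y + z) = L y + L z.
  by rewrite -{1}[y]scale1r L_lin mul1r.
have L_sum (F : 'I_n -> 'I_n -> X) : L (\sum_k F k) = \sum_k L (F k).
  by apply: (big_morph L LD L0).
pose delta k (v : X) : 'I_n -> X := fun j => if j == k then v else 0.
have deltaE y : \sum_k delta k (y k) = y.
  apply/funext => j; rewrite fct_sumE (bigD1 j)//= /delta eqxx big1 ?addr0//.
  by move=> k; rewrite eq_sym => /negbTE ->.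
exists (fun k v => L (delta k v)); split.
- move=> k a v w; rewrite -L_lin; congr L; apply/funext => j.
  rewrite /delta [RHS]/= /GRing.add /= /GRing.scale /=.
  by case: eqP => // _; rewrite scaler0 addr0.
- move=> v; pose s k := Num.sg (L (delta k v)).
  have E : \sum_k `|L (delta k v)| = L (fun k => s k *: v).
    rewrite -(deltaE (fun k => s k *: v)) L_sum; apply: eq_bigr => k _.
    rewrite normrEsg -/(s k) -[LHS]addr0 -L0 -L_lin addr0; congr L.
    apply/funext => j; rewrite /delta /GRing.scale /=.
    by case: eqP => // _; rewrite scaler0.
  rewrite E; apply: le_trans (Lle _ I) _.
  rewrite -(norm_modulus v); apply: joinnorm_le => [|k].
    exact: modulus_ge0.
  apply: vle_trans (modulusZ_le _ _) _; rewrite -[X in vle _ X]scale1r.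
  by apply: vleZr; [exact: modulus_ge0|rewrite /s normr_sg lern1 leq_b1].
- by rewrite -L_sum deltaE Lx.
Qed.

End norming_functionals.

(** * Extension of operators from the subspace, with pointwise bounds *)

Lemma POE1_extension {R : realType} {E : normedModType R} (G : set E) :
  G 0 -> complemented G \/ POE1 G ->
  exists2 C : R, 0 <= C & forall n (T : E -> ell1 R n) (M : R), 0 <= M ->
    linear_on G T -> (forall x, G x -> `|T x| <= M * `|x|) ->
    exists T' : {linear E -> ell1 R n},
      (forall x, G x -> T' x = T x) /\ forall x, `|T' x| <= C * M * `|x|.
Proof.
move=> G0 [[P [cP PP rP]]|[C poe]].
  have GP x : G (P x) by rewrite -rP; exists x.
  have [C C0 PC] : exists2 C : R, 0 <= C & forall x, `|P x| <= C * `|x|.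
    have /linear_boundedP[r [rreal hr]] := continuous_linear_bounded 0 (cP 0).
    exists (`|r| + 1); first by rewrite addr_ge0.
    by apply: hr; rewrite (le_lt_trans (ler_norm r))// ltrDl.
  exists C => // n T M M0 T_lin TM.
  (* In the complemented case the projection itself extends every operator. *)
  pose TP x := T (P x).
  have TP_lin : linear TP by move=> a x y; rewrite /TP linearP; exact: T_lin.
  pose TPm := GRing.isLinear.Build R E (ell1 R n) *:%R TP TP_lin.
  pose T' : {linear E -> ell1 R n} := HB.pack TP TPm.
  exists T'; split=> [x Gx|x].
    by rewrite /T' /= /TP; move: Gx; rewrite -rP => -[y _ <-]; rewrite PP.
  apply: le_trans (TM _ (GP x)) _; by rewrite [C * M]mulrC -mulrA ler_wpM2l.
exists `|C| => // n T M M0 T_lin TM.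
have bT : bounded_operator_on G T by exists M.
have [T' [[B bT'] T'T T'C]] := poe n T T_lin bT.
exists T'; split=> // x.
have opM : operator_norm_on G T <= M.
  apply: ge_sup; first by exists `|T 0|, 0 => //; split => //=; rewrite normr0.
  move=> _ [y [Gy y1] <-]; apply: le_trans (TM _ Gy) _.
  by rewrite -[leRHS]mulr1 ler_wpM2l.
have op_ub (y : E) : `|y| <= 1 -> `|T' y| <= operator_norm_on setT T'.
  move=> y1; apply: ub_le_sup; last by exists y.
  exists `|B| => _ [z [_ z1] <-]; apply: le_trans (bT' z I) _.
  apply: le_trans (ler_wpM2r (normr_ge0 z) (ler_norm B)) _.
  by rewrite -[leRHS]mulr1 ler_wpM2l.
have op0 : 0 <= operator_norm_on G T.
  apply: le_trans (normr_ge0 (T 0)) _; apply: ub_le_sup.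
    exists M => _ [z [Gz z1] <-]; apply: le_trans (TM _ Gz) _.
    by rewrite -[leRHS]mulr1 ler_wpM2l.
  by exists 0 => //; split => //=; rewrite normr0.
have [->|x0] := eqVneq x 0; first by rewrite linear0 !normr0 mulr0.
have nx : 0 < `|x| by rewrite normr_gt0.
(* Normalizing [x] turns the bound on the supremum over the unit ball back into a pointwise one. *)
have := op_ub (`|x|^-1 *: x).
rewrite linearZ/= !normrZ normfV normr_id mulVf ?gt_eqF// => /(_ (lexx _)).
rewrite ler_pdivrMl// mulrC => h; apply: le_trans h _; rewrite ler_wpM2r//.
apply: le_trans T'C _; apply: le_trans (ler_wpM2r op0 (ler_norm C)) _.
exact: ler_wpM2l.
Qed.

(** * Transfer of the upper estimate along the embedding *)

Theorem corollary9p29 (R : realType) (p : R) (E F : banachLatticeType R)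
    (iota : {linear F -> E}) :
  1 < p -> p < 2 ->
  isomorphic_embedding iota ->
  complemented (range iota) \/ POE1 (range iota) ->
  upper_estimate p E ->
  upper_estimate p F.
Proof.
move=> p1 p2 [c [c' [c0 cc']]] compl [C0' upE'].
have p0 : 0 < p by apply: lt_trans p1.
have ip0 : p^-1 != 0 by rewrite gt_eqF// invr_gt0.
pose C0 := `|C0'|.
have upE n (x : 'I_n -> E) : `|\big[vjoin/0]_(k < n) modulus (x k)| <=
    C0 * (\sum_(k < n) `|x k| `^ p) `^ p^-1.
  by apply: le_trans (upE' n x) _; rewrite ler_wpM2r ?powR_ge0// ler_norm.
have [|C C_ge0 ext] := POE1_extension _ compl.
  by exists 0 => //; rewrite linear0.
(* The constant of [trace_le], with [K = C * c^-1]: inverting [iota] on its range costs [c^-1],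
   extending costs [C]. *)
pose M := 2 * (6 * C0 * (1 + (1 - p / 2)^-1)) * (C * c^-1).
have ic0 : 0 <= c^-1 by rewrite invr_ge0 ltW.
have M_ge0 : 0 <= M.
  have q0 : 0 <= (1 - p / 2)^-1.
    by rewrite invr_ge0 subr_ge0 ler_pdivrMr// mul1r ltW.
  by rewrite /M /C0 !mulr_ge0 ?addr_ge0.
exists (M * `|c'|) => n x.
(* The random weights need an index; for [n = 0] both sides vanish. *)
case: n x => [|n'] x; first by rewrite !big_ord0 normr0 powR0// mulr0.
set n := n'.+1 in x *.
have [f [f_lin f_le fx]] := norming_functionals x.
have iota_inj : injective iota.
  move=> y z yz; apply/eqP; rewrite -subr_eq0 -normr_le0 -(ler_pM2l c0) mulr0.
  by have /andP[+ _] := cc' (y - z); rewrite linearB yz subrr normr0.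
(* The default 0 is taken only outside the range of [iota], where the values of [T] are
   irrelevant. *)
pose inv z := xget 0 [set y | iota y = z].
have iotaK y : inv (iota y) = y.
  by apply: iota_inj; exact: (xgetI 0 (erefl : [set v | iota v = iota y] y)).
pose T (z : E) : ell1 R n := \row_k f k (inv z).
have T_lin : linear_on (range iota) T.
  move=> a _ _ [y _ <-] [z _ <-]; rewrite /T -linearP !iotaK.
  by apply/rowP => k; rewrite !mxE f_lin.
have TE y k : (T (iota y) : 'rV_n) 0 k = f k y by rewrite mxE iotaK.
have T_le z : range iota z -> `|T z| <= c^-1 * `|z|.
  move=> [y _ <-].
  have -> : `|T (iota y)| = \sum_k `|f k y|.
    by apply: eq_bigr => k _; rewrite TE.
  apply: le_trans (f_le y) _; rewrite ler_pdivlMl//.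
  by have /andP[] := cc' y.
have [T' [T'T T'_le]] := ext n T _ ic0 T_lin T_le.
pose g k z : R := (T' z : 'rV_n) 0 k.
have g_lin k a y z : g k (a *: y + z) = a * g k y + g k z.
  by rewrite /g linearP !mxE.
(* At the vectors [iota (x k)] the extension agrees with the [f k], so the trace is the norm of the
   join in [F]. *)
have := trace_le p1 p2 (normr_ge0 C0') upE (isT : (0 < n)%N) g_lin
  (mulr_ge0 C_ge0 ic0) T'_le (fun k => iota (x k)).
have -> : \sum_k g k (iota (x k)) = \sum_k f k (x k).
  by apply: eq_bigr => k _; rewrite /g T'T ?TE//; exists (x k).
rewrite fx => /le_trans; apply.
rewrite -/C0 -/M -[leRHS]mulrA ler_wpM2l//.
have iota_le y : `|iota y| <= `|c'| * `|y|.
  have /andP[_ h] := cc' y; apply: le_trans h _.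
  by rewrite ler_wpM2r// ler_norm.
have S0 (G : banachLatticeType R) (h : 'I_n -> G) : 0 <= \sum_k `|h k| `^ p.
  by apply: sumr_ge0 => k _; exact: powR_ge0.
have -> : `|c'| = (`|c'| `^ p) `^ p^-1.
  by rewrite -powRrM divff ?gt_eqF// powRr1.
rewrite -powRM ?powR_ge0 ?S0//.
apply: ge0_ler_powR; rewrite ?nnegrE ?invr_ge0 ?(ltW p0) ?S0//.
  by rewrite mulr_ge0 ?powR_ge0 ?S0.
rewrite mulr_sumr; apply: ler_sum => k _; rewrite -powRM//.
by apply: ge0_ler_powR; rewrite ?nnegrE ?(ltW p0) ?mulr_ge0.
Qed.
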